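(* The optimal density of a $(3,3)$ broadcast for $H_{\infty,\infty}$ satisfies \[\delta_{3,3}(H_{\infty,\infty})\leq \frac14.\]
   Context: The infinite truncated square tiling graph $H_{\infty,\infty}$ has vertex set $\{(a,(x,y)) : a\in\mathbb{Z}_4,\ (x,y)\in\mathbb{Z}^2\}$. Its edges are: $(a,(x,y))\sim(a+1,(x,y))$ with $a+1$ taken modulo 4 (so each $(x,y)$ carries a 4-cycle whose vertices $0,1,2,3$ are its top, right, bottom, left vertices); $(1,(x,y))\sim(3,(x+1,y))$; and $(0,(x,y))\sim(2,(x,y+1))$. For $(x,y)\in\mathbb{Z}^2$ the octagon $O_{x,y}$ is the 8-cycle through $(0,(x,y)),(1,(x,y)),(3,(x+1,y)),(0,(x+1,y)),(2,(x+1,y+1)),(3,(x+1,y+1)),(1,(x,y+1)),(2,(x,y+1))$, in this cyclic order. For a graph $G$ and integers $1\le r\le t$, a set $T\subseteq V(G)$ is a $(t,r)$ broadcast of $G$ if every $u\in V(G)$ satisfies $\sum_{v\in T,\ d(u,v)<t}(t-d(u,v))\ge r$, where $d$ is the graph distance in $G$. The broadcast density of a $(t,r)$ broadcast $T$ for $H_{\infty,\infty}$ is $\lim_{n\to\infty}|T\cap V(B_n)|/|V(B_n)|$, where $B_n$ is the finite portion of the graph given by the union of the octagons $O_{x,y}$ with $-n\le x,y\le n-1$. The optimal density $\delta_{t,r}(H_{\infty,\infty})$ is the minimum (infimum) of the broadcast densities over all $(t,r)$ broadcasts $T$ of $H_{\infty,\infty}$ for which the limit exists. *)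

(* Defs.v *)
From HB Require Import structures.
From mathcomp Require Import all_boot all_order all_algebra finmap.
From mathcomp Require Import all_classical all_reals all_analysis.
Set Implicit Arguments.
Unset Strict Implicit.
Unset Printing Implicit Defensive.
Import Order.TTheory GRing.Theory Num.Theory.
Import numFieldNormedType.Exports.
Local Open Scope classical_set_scope.
Local Open Scope ring_scope.

(* The infimum is taken in the extended reals, so vertices in different
   components are at distance +oo. *)
Definition gdist (R : realType) (V : eqType) (e : rel V) (u v : V) : \bar R :=
  ereal_inf [set ((size p)%:R%:E : \bar R) | p in
               [set p : seq V | path e u p /\ last u p = v]].

Definition is_broadcast (R : realType) (V : choiceType) (e : rel V)
    (t r : nat) (T : set V) : Prop :=
  forall u : V,
    (r%:R%:E <= \esum_(v in T `&` [set v | gdist R e u v < t%:R%:E])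
                  (t%:R%:E - gdist R e u v))%E.

Definition vertex : choiceType := ('Z_4 * (int * int))%type.

Definition arc (u v : vertex) : bool :=
  let: (a, (x, y)) := u in
  [|| v == (a + 1, (x, y)),
      (a == 1) && (v == (3, (x + 1, y)))
    | (a == 0) && (v == (2, (x, y + 1)))].

Definition adj : rel vertex := fun u v => arc u v || arc v u.

Definition octagon (x y : int) : seq vertex :=
  [:: (0, (x, y)); (1, (x, y));
      (3, (x + 1, y)); (0, (x + 1, y));
      (2, (x + 1, y + 1)); (3, (x + 1, y + 1));
      (1, (x, y + 1)); (2, (x, y + 1))].

Definition VB (n : nat) : set vertex :=
  \bigcup_(p in [set p : int * int | (- n%:Z <= p.1 <= n%:Z - 1) &&
                                     (- n%:Z <= p.2 <= n%:Z - 1)])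
    [set` octagon p.1 p.2].

Definition density_seq (R : realType) (T : set vertex) : R^nat := fun n =>
  #|` fset_set (T `&` VB n)|%:R / #|` fset_set (VB n)|%:R.

(* With the infimum in the extended reals, an empty family of broadcasts
   would give +oo, not a default real value. *)
Definition optimal_density (R : realType) (t r : nat) : \bar R :=
  ereal_inf [set d%:E | d in
    [set d : R | exists T : set vertex,
       is_broadcast R adj t r T /\ density_seq R T @ \oo --> d]].

(* Main.v *)
Require Import Defs.
From mathcomp Require Import all_boot all_order all_algebra.
From mathcomp Require Import all_classical all_reals all_analysis.
From mathcomp Require Import finmap zify ring.
Import Order.TTheory GRing.Theory Num.Theory.
Import numFieldNormedType.Exports.
Local Open Scope classical_set_scope.
Local Open Scope ring_scope.

(** The broadcast consists of the top vertices, one per 4-cycle. A top vertex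
    gives itself 3. The other vertices of the 4-cycle over (x, y) lie inside a
    walk of length 3 between two top vertices:
      (0, (x, y - 1)), (2, (x, y)), (1 or 3, (x, y)), (0, (x, y));
    its distances to the two ends add up to at most 3, and both are below 3,
    so it receives at least 2 * 3 - 3 = 3 ([tops_broadcast]).

    As for the density, the quarter turn about the center of the 4-cycle over
    the origin preserves every B_n and permutes top, right, bottom and left
    vertices cyclically; so exactly a quarter of the vertices of B_n are tops
    ([card_VB]), and the density sequence is constantly 1/4 from n = 1 on. *)

(** * Reception along walks *)

Lemma gdist_le_walk (R : realType) (V : eqType) (e : rel V) (u : V) p :
  path e u p -> (gdist R e u (last u p) <= (size p)%:R%:E)%E.
Proof. by move=> ep; apply: ereal_inf_lbound; exists p. Qed.

(** Walks of length less than t from u to distinct vertices of T certify a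
    lower bound on what u receives from T: no exact distance is needed. *)
Lemma reception_ge_walks (R : realType) (V : choiceType) (e : rel V)
    (t : nat) (T : set V) (u : V) (s : seq V) (w : V -> seq V) :
    uniq s ->
    {in s, forall v, [/\ T v, path e u (w v), last u (w v) = v
                       & (size (w v) < t)%N]} ->
  ((\sum_(v <- s) (t - size (w v)))%N%:R%:E <=
   \esum_(v in T `&` [set v | gdist R e u v < t%:R%:E])
     (t%:R%:E - gdist R e u v))%E.
Proof.
move=> s_uniq ws; apply: esum_ge.
have le_w v : v \in s -> (gdist R e u v <= (size (w v))%:R%:E)%E.
  by case/ws=> _ ep {2}<- _; apply: gdist_le_walk.
exists [set` s].
  split=> [|v /= vs]; first exact: finite_seq.
  have [Tv _ _ lt_t] := ws v vs; split=> //=.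
  by apply: le_lt_trans (le_w v vs) _; rewrite lte_fin ltr_nat.
rewrite -fsbig_seq // natr_sum -sumEFin big_seq [leRHS]big_seq.
apply: lee_sum => v vs; have [_ _ _ lt_t] := ws v vs.
by rewrite natrB 1?ltnW // EFinB leeB // le_w.
Qed.

(** * The broadcast of top vertices *)

Definition tops : set vertex := [set v | v.1 = 0].

Lemma Z4P (P : 'Z_4 -> Prop) : P 0 -> P 1 -> P 2 -> P 3 -> forall a, P a.
Proof.
move=> P0 P1 P2 P3 [[|[|[|[|//]]]] lt4].
- by rewrite (_ : Ordinal lt4 = 0) //; apply: val_inj.
- by rewrite (_ : Ordinal lt4 = 1) //; apply: val_inj.
- by rewrite (_ : Ordinal lt4 = 2) //; apply: val_inj.
- by rewrite (_ : Ordinal lt4 = 3) //; apply: val_inj.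
Qed.

Lemma tops_broadcast (R : realType) : is_broadcast R adj 3 3 tops.
Proof.
move=> [a [x y]].
pose up : vertex := (0, (x, y)); pose down : vertex := (0, (x, y - 1)).
have neq : up != down by rewrite /up /down !xpair_eqE !eqxx /=; lia.
pose walks p q v := if v == up then p else q : seq vertex.
have two_walks (u : vertex) (p q : seq vertex) :
    path adj u p -> path adj u q -> last u p = up -> last u q = down ->
    size p + size q = 3 -> (0 < size p)%N -> (0 < size q)%N ->
  (3%:R%:E <=
   \esum_(v in tops `&` [set v | gdist R adj u v < 3%:R%:E])
     (3%:R%:E - gdist R adj u v))%E.
  move=> up_p up_q lp lq szpq p0 q0.
  have := @reception_ge_walks R _ adj 3 tops u [:: up; down] (walks p q).
  rewrite !big_cons big_nil /walks eqxx eq_sym (negPf neq).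
  rewrite (_ : _ + _ = 3)%N; last by lia.
  apply=> [|v]; first by rewrite /= inE neq.
  rewrite !inE => /orP[] /eqP ->; rewrite ?eqxx.
    by split=> //; lia.
  by rewrite eq_sym (negPf neq); split=> //; lia.
have adj_down : adj (2, (x, y)) down.
  by rewrite /adj /arc /down /= subrK !eqxx ?orbT.
(* Consecutive vertices of the 4-cycle over (x, y) are adjacent. *)
have cycle4 (b c : 'Z_4) : (c == b + 1) || (b == c + 1) ->
    adj (b, (x, y)) (c, (x, y)).
  rewrite /adj /arc /= !xpair_eqE !eqxx !andbT.
  by case/orP=> /eqP->; rewrite !eqxx ?orbT.
move: a; apply: Z4P.
- have := @reception_ge_walks R _ adj 3 tops up [:: up] (fun=> [::]).
  by rewrite big_seq1; apply=> // v; rewrite inE => /eqP->.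
- apply: (two_walks _ [:: up] [:: (2, (x, y)); down]) => //=;
    by rewrite ?adj_down ?cycle4.
- apply: (two_walks _ [:: (1, (x, y)); up] [:: down]) => //=;
    by rewrite ?adj_down ?cycle4.
- apply: (two_walks _ [:: up] [:: (2, (x, y)); down]) => //=;
    by rewrite ?adj_down ?cycle4.
Qed.

(** * The density of the top vertices *)

(** Clockwise, so that a top vertex goes to a right vertex. *)
Definition quarter_turn (v : vertex) : vertex :=
  (v.1 + 1, (v.2.2, - v.2.1)).

Lemma quarter_turn_inj : injective quarter_turn.
Proof.
move=> [a [x y]] [b [z t]] vw.
have /addIr/= -> := congr1 fst vw.
by have [-> /oppr_inj ->] := congr1 snd vw.
Qed.

Lemma quarter_turn4 v : iter 4 quarter_turn v = v.
Proof.
case: v => a [x y]; rewrite /quarter_turn /= !opprK.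
by congr (_, _); move: a; apply: Z4P; apply: val_inj.
Qed.

(** The turn sends the octagon at (x, y), with center (x + 1/2, y + 1/2), to
    the one with center (y + 1/2, - x - 1/2), and -n <= - x - 1 <= n - 1. *)
Lemma quarter_turn_VB n v : VB n v -> VB n (quarter_turn v).
Proof.
case=> [[x y] /= /andP[xn yn] vO]; exists (y, - x - 1) => /=.
  by apply/andP; split; lia.
move: vO; rewrite /octagon !inE.
by do 7?case/orP; move/eqP->;
  rewrite /quarter_turn /= ?opprD ?subrK !xpair_eqE ?eqxx ?orbT.
Qed.

Lemma iter_quarter_turn_VB n k v : VB n v -> VB n (iter k quarter_turn v).
Proof. by move=> Bv; elim: k => //= k; apply: quarter_turn_VB. Qed.

Lemma finite_VB n : finite_set (VB n).
Proof.
apply: bigcup_finite => [|p _]; last exact: finite_seq.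
apply: (@sub_finite_set _ _
  ((fun p : nat * nat => (p.1%:Z - n%:Z, p.2%:Z - n%:Z)) @`
   (`I_n.*2 `*` `I_n.*2))); last first.
  exact: finite_image (finite_setX (finite_II _) (finite_II _)).
move=> [x y] /= /andP[xn yn].
exists (absz (x + n%:Z), absz (y + n%:Z)); first by split=> /=; lia.
by congr (_, _) => /=; lia.
Qed.

(** The four classes of vertices of B_n are carried onto each other by the
    quarter turn. *)
Lemma card_VB n : (#|` fset_set (VB n)| = 4 * #|` fset_set (tops `&` VB n)|)%N.
Proof.
pose F (k : nat) : set vertex := [set v : vertex | v.1 = k :> nat] `&` VB n.
have finF k : finite_set (F k) by apply: finite_setIr; apply: finite_VB.
have -> : tops `&` VB n = F 0%N.
  congr (_ `&` _); apply/seteqP; split=> v /=; first by move=> ->.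
  by move=> v0; apply: val_inj.
have -> : VB n = \big[setU/set0]_(k < 4) F k.
  rewrite -bigcup_mkord; apply/seteqP; split=> [v Bv | v [k _ []]] //.
  by exists (v.1 : nat) => //=; exact: (ltn_ord v.1).
rewrite -trivIset_sum_card //; last first.
  by move=> i j _ _ [v [[/= <- _] [/= <- _]]].
rewrite -[in RHS](card_ord 4) -sum_nat_const; apply: eq_bigr => k _.
apply/esym/fcard_eq => //.
suff -> : F k = iter k quarter_turn @` F 0%N.
  rewrite card_eq_sym; apply: inj_card_eq => v w _ _.
  by elim: (k : nat) => //= i IH /quarter_turn_inj/IH.
have turn1 m (v : vertex) : (iter m quarter_turn v).1 = v.1 + m%:R.
  by elim: m => [|m IH]; rewrite ?addr0 //= IH -addrA -natr1.
apply/seteqP; split=> [v [/= vk Bv] | _ [v [/= v0 Bv] <-]].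
  exists (iter (4 - k) quarter_turn v); last first.
    by rewrite -iterD subnKC ?quarter_turn4 // ltnW.
  split; last exact: iter_quarter_turn_VB.
  rewrite /= turn1 (_ : v.1 = k%:R) -?natrD ?subnKC ?(ltnW (ltn_ord k)) //.
  by apply: val_inj; rewrite /= vk Zp_nat /= modn_small.
split; last exact: iter_quarter_turn_VB.
by rewrite /= turn1 (_ : v.1 = 0) ?add0r ?Zp_nat /= ?modn_small //;
  apply: val_inj.
Qed.

(** B_0 is empty, which is why the index starts at 1. *)
Lemma density_tops (R : realType) n : density_seq R tops n.+1 = 1 / 4.
Proof.
rewrite /density_seq card_VB natrM.
suff tops0 : #|` fset_set (tops `&` VB n.+1)|%:R != 0 :> R by field.
rewrite pnatr_eq0 cardfs_eq0; apply/eqP => /(congr1 (fun A => (0, (0, 0)) \in A)).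
rewrite in_fset_set; last by apply: finite_setIr; apply: finite_VB.
rewrite inE => /negP; apply; apply/asboolP; split=> //.
by exists (0, 0) => //=; lia.
Qed.

Theorem theorem4p6 (R : realType) :
  (optimal_density R 3 3 <= (1 / 4 : R)%:E)%E.
Proof.
apply: ereal_inf_lbound; exists (1 / 4) => //; exists tops.
split; first exact: tops_broadcast.
apply: cvg_near_cst; exists 1%N => // -[//|n] _.
exact: density_tops.
Qed.
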